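(* Let $\mathcal{Q}=({}^{<\omega}\omega,\triangleleft)$ be Cohen forcing. For all $M_1,M_2\in\mathbf{K}_{\rm hom}$, $M_1\cong M_2$ if and only if $\Vdash_{\mathcal{Q}} M_1\cong M_2$.
   Context: $\mathbf{K}_{\rm hom}$ is the class of homogeneous linear orders: all dense linear orders with no endpoints such that any non-empty open interval is isomorphic to the entire linear order. ${}^{<\omega}\omega$ is the set of finite sequences of natural numbers, and $\triangleleft$ is the initial-segment (extension) ordering; longer sequences are stronger conditions. *)

(* Defs.v *)
From mathcomp Require Import all_boot all_order.
From mathcomp Require Import boolp wochoice.

Set Implicit Arguments.
Unset Strict Implicit.
Unset Printing Implicit Defensive.

Import Order.TTheory.
Local Open Scope order_scope.

Definition rel_iso (A B : Type) (R : rel A) (S : rel B) : Prop :=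
  exists2 f : A -> B, bijective f & forall x y, S (f x) (f y) = R x y.

Definition order_iso d1 d2 (M1 : orderType d1) (M2 : orderType d2) : Prop :=
  rel_iso (<%O : rel M1) (<%O : rel M2).

Definition interval_lt d (M : orderType d) (a b : M) :
  rel {x : M | a < x < b} := fun x y => sval x < sval y.

(* The intervals considered have both end points in M; that open rays are
   isomorphic to M as well then follows. *)
Record homogeneous_order d (M : orderType d) : Prop := HomogeneousOrder {
  ho_dense : forall x y : M, x < y -> exists z : M, x < z < y;
  ho_nomin : forall x : M, exists y : M, y < x;
  ho_nomax : forall x : M, exists y : M, x < y;
  ho_interval : forall a b : M, (exists x : M, a < x < b) ->
    rel_iso (@interval_lt d M a b) (<%O : rel M) }.

(* Ground-model sets, as well-founded trees: [GSet elt] is the set of the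
   [elt i].  Set-theoretic equality is [geq], not Leibniz equality. *)
Inductive gset : Type := GSet (I : Type) (elt : I -> gset).

Fixpoint geq (a b : gset) : Prop :=
  match a, b with
  | GSet X f, GSet Y g =>
      (forall i, exists j, geq (f i) (g j)) /\
      (forall j, exists i, geq (f i) (g j))
  end.

Definition gupair (a b : gset) : gset := GSet (fun i : bool => if i then a else b).
Definition gopair (a b : gset) : gset := gupair (gupair a a) (gupair a b).

(* Elements of a type are not sets.  A coding [c] of T turns a structure on T
   into a structure of the ground model, with underlying set {c x | x : T};
   by [coding_exists] no type with decidable equality is left out. *)
Definition coding (T : Type) (c : T -> gset) : Prop :=
  forall x y, geq (c x) (c y) -> x = y.

Lemma coding_exists (T : eqType) : exists c : T -> gset, coding c.
Proof.
have [R woR] := well_ordering_principle T.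
pose below x y := R x y && (x != y).
have wf_below : well_founded below.
  move=> x; apply: contrapT => nx.
  have [|z [[/asboolP nz minz] _]] := woR (fun y => `[< ~ Acc below y >]).
    by exists x; apply/asboolP.
  case: nz; constructor=> y /andP[Ryz /eqP nyz]; apply: contrapT => ny.
  have Rzy : R z y by apply: minz; apply/asboolP.
  have [|m [_ um]] := woR (pred2 y z); first by exists y; rewrite inE eqxx.
  have Rrefl w : R w w.
    have [|m' [[/eqP-> m'w] _]] := woR (pred1 w); first by exists w; rewrite inE.
    exact: (m'w w (eqxx w)).
  have my : m = y.
    by apply: um; split; [rewrite inE eqxx | move=> w /orP[] /eqP->].
  apply: nyz; rewrite -my; apply: um.
  by split; [rewrite inE eqxx orbT | move=> w /orP[] /eqP->].
have total x y : x <> y -> below x y \/ below y x.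
  move=> nxy; have [|m [[xym minm] _]] := woR (pred2 x y).
    by exists x; rewrite inE eqxx.
  case/orP: xym => /eqP e; subst m; [left|right]; apply/andP; split.
  - by apply: minm; rewrite inE eqxx orbT.
  - exact/eqP.
  - by apply: minm; rewrite inE eqxx.
  - by apply/eqP => /esym.
pose c := Fix wf_below (fun=> gset)
  (fun x rec => GSet (fun y : {y | below y x} => rec (sval y) (svalP y))).
have cE x : c x = GSet (fun y : {y | below y x} => c (sval y)).
  rewrite /c Fix_eq // => {}x f g fg; congr GSet.
  by apply: functional_extensionality_dep => y; apply: fg.
exists c => x; clearbody c; elim/(well_founded_ind wf_below): x => x IH y exy.
apply: contrapT => nxy.
have [lt|lt] := total _ _ nxy; move: exy; rewrite cE [c y]cE /= => -[fwd bwd].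
- have [[z ltz] /= e] := bwd (exist _ x lt).
  by have := IH z ltz x e => zx; move: ltz; rewrite /below zx eqxx andbF.
- have [[z ltz] /= e] := fwd (exist _ y lt).
  by have := IH y lt z e => zy; move: ltz; rewrite /below zy eqxx andbF.
Qed.

Definition gcarrier (T : Type) (c : T -> gset) : gset := GSet c.

Definition glt d (M : orderType d) (c : M -> gset) : gset :=
  GSet (fun xy : {xy : M * M | xy.1 < xy.2} =>
          gopair (c (sval xy).1) (c (sval xy).2)).

Definition cohen : Type := seq nat.

Definition stronger (q p : cohen) : Prop := prefix p q.

Definition dense_below (p : cohen) (D : cohen -> Prop) : Prop :=
  forall q, stronger q p -> exists2 r, stronger r q & D r.

(* [Name elt cond] is the name {(elt i, cond i) | i : I}. *)
Inductive name : Type :=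
  Name (I : Type) (elt : I -> name) (cond : I -> cohen).

Fixpoint check (a : gset) : name :=
  match a with
  | GSet _ f => Name (fun i => check (f i)) (fun=> [::])
  end.

(* p forces s = t: whenever (s', c) is in s and q extends both p and c, q forces
   s' to be in t (see [force_mem]), and symmetrically. *)
Fixpoint force_eq (s t : name) (p : cohen) : Prop :=
  match s, t with
  | Name X f c, Name Y g d =>
      (forall i q, stronger q p -> stronger q (c i) ->
         dense_below q (fun r =>
           exists2 j, stronger r (d j) & force_eq (f i) (g j) r)) /\
      (forall j q, stronger q p -> stronger q (d j) ->
         dense_below q (fun r =>
           exists2 i, stronger r (c i) & force_eq (f i) (g j) r))
  end.

Definition force_mem (s t : name) (p : cohen) : Prop :=
  match t with
  | Name _ g d => dense_below p (fun r =>
      exists2 j, stronger r (d j) & force_eq s (g j) r)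
  end.

(* The forcing language: formulas of set theory with names as parameters.
   A quantified formula is given by its instances at all names. *)
Inductive formula : Type :=
  | Mem of name & name
  | Eq of name & name
  | Not of formula
  | And of formula & formula
  | All of (name -> formula).

Fixpoint forces (p : cohen) (phi : formula) : Prop :=
  match phi with
  | Mem s t => force_mem s t p
  | Eq s t => force_eq s t p
  | Not phi => forall q, stronger q p -> ~ forces q phi
  | And phi psi => forces p phi /\ forces p psi
  | All F => forall t, forces p (F t)
  end.

Definition forced (phi : formula) : Prop := forall p, forces p phi.

Definition Or phi psi := Not (And (Not phi) (Not psi)).
Definition Imp phi psi := Not (And phi (Not psi)).
Definition Iff phi psi := And (Imp phi psi) (Imp psi phi).
Definition Ex (F : name -> formula) := Not (All (fun t => Not (F t))).
Definition AllIn A (F : name -> formula) := All (fun x => Imp (Mem x A) (F x)).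
Definition ExIn A (F : name -> formula) := Ex (fun x => And (Mem x A) (F x)).

Definition IsUpair z x y :=
  All (fun w => Iff (Mem w z) (Or (Eq w x) (Eq w y))).
Definition IsOpair z x y :=
  All (fun w => Iff (Mem w z) (Or (IsUpair w x x) (IsUpair w x y))).
Definition MemPair x y R := ExIn R (fun z => IsOpair z x y).

Definition IsFunction f A B :=
  And (AllIn f (fun z => ExIn A (fun x => ExIn B (fun y => IsOpair z x y))))
 (And (AllIn A (fun x => ExIn B (fun y => MemPair x y f)))
      (AllIn A (fun x => AllIn B (fun y => AllIn B (fun y' =>
         Imp (And (MemPair x y f) (MemPair x y' f)) (Eq y y')))))).

Definition IsInjective f A B :=
  AllIn A (fun x => AllIn A (fun x' => AllIn B (fun y =>
    Imp (And (MemPair x y f) (MemPair x' y f)) (Eq x x')))).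

Definition IsSurjective f A B :=
  AllIn B (fun y => ExIn A (fun x => MemPair x y f)).

Definition PreservesRel f A R B S :=
  AllIn A (fun x => AllIn A (fun x' => AllIn B (fun y => AllIn B (fun y' =>
    Imp (And (MemPair x y f) (MemPair x' y' f))
        (Iff (MemPair x x' R) (MemPair y y' S)))))).

(* (A, R) and (B, S) are isomorphic. *)
Definition Isomorphic A R B S :=
  Ex (fun f => And (IsFunction f A B)
              (And (IsInjective f A B)
              (And (IsSurjective f A B)
                   (PreservesRel f A R B S)))).

(* Main.v *)
From mathcomp Require Import all_boot all_order.
From mathcomp Require Import ssralg ssrint boolp zify.
Require Import Defs.

(** If [M1] and [M2] are isomorphic, the check name of the graph of an
isomorphism is forced to be one.  The content is the converse.

Let [p] force that [phi] names an isomorphism.  Each condition [s] below [p]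
decides some of its values; write [F s x y] when [s] forces [x] to be sent to
[y].  Every [F s] is a partial isomorphism of the ground model, and below any
condition any given point gets a value, and an argument, from some further
condition.  What matters about Cohen forcing is that there
are only countably many conditions ([approximation]).  Values decided by incompatible
conditions do not fit together, so the isomorphism must be rebuilt.

The main idea is to look at the cuts decided by a condition [s]: pairs of an
initial segment of [M1] and one of [M2] such that [s] forces the first to be
mapped onto the second.  Points of [M1] which no decided cut separates form
convex blocks, and likewise in [M2]; the two families of blocks correspond to
each other in order.  The block of [x] is the convex hull of the orbit of [x]
under moving to a possible value of [x] and back to a possible argument of that
value.  The orbit is countable because the forcing is.  Hence a block that is
not a single point has countable cofinality and coinitiality and no end points:
it is spanned by a chain indexed by the integers, whatever the cofinality of [M1]
([coarse_iso_unseparated]).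

Blocks of this shape can be treated anew with any other condition [t].  Match the
integer chains of two corresponding blocks; they cut the blocks into intervals.
On such an interval, let some [s] below [t] decide the values of the two end
points and use the blocks of [s]; the image interval is not the prescribed one,
but it is isomorphic to it because [M2] is homogeneous.  Every point with a value
decided by [t] thereby becomes a block of its own, and the new blocks again are
points or are spanned by integer chains ([coarse_iso_sharpen]).

Doing so for all conditions in turn, on both sides, isolates each point of [M1]
and of [M2] after finitely many steps, and the correspondence in the limit is an
isomorphism ([coarse_iso_limit], [approximation_iso]). *)

Set Implicit Arguments.
Unset Strict Implicit.
Unset Printing Implicit Defensive.

Import Order.TTheory.
Local Open Scope order_scope.

(** * Convex sets spanned by chains of integers *)

Definition spanned d (M : orderType d) (e : int -> M) (x : M) : Prop :=
  exists i j, e i < x < e j.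

Definition zspan d (M : orderType d) (C : M -> Prop) : Prop :=
  exists2 e : int -> M, {homo e : i j / i < j} & forall x, C x <-> spanned e x.

Definition cell d (M : orderType d) (e : int -> M) (i : int) (x : M) : Prop :=
  e i < x < e (i + 1)%R.

Lemma spanned_mem d (M : orderType d) (e : int -> M) (i : int) :
  {homo e : i j / i < j} -> spanned e (e i).
Proof. by move=> e_lt; exists (i - 1)%R, (i + 1)%R; rewrite !e_lt //; lia. Qed.

(** Countable cofinality and coinitiality suffice: starting anywhere, move beyond
the [n]-th point of the given countable set at step [n], upwards and downwards;
the absence of end points makes each move strict. *)
Lemma zspan_countable d (M : orderType d) (C : M -> Prop) (o : nat -> M) :
    (forall x y z, C x -> C z -> x < y < z -> C y) ->
    (forall n, C (o n)) ->
    (forall x, C x -> exists n, o n <= x) ->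
    (forall x, C x -> exists n, x <= o n) ->
    (forall x, C x -> exists y, C y /\ y < x) ->
    (forall x, C x -> exists y, C y /\ x < y) ->
  zspan C.
Proof.
move=> Cconv Co o_coinit o_cofin nomin nomax.
have [dn dnP] : {dn : M -> M & forall x, C x -> C (dn x) /\ dn x < x}.
  apply: (@choice _ _ (fun x y => C x -> C y /\ y < x)) => x.
  by have [/nomin[y]|?] := pselect (C x); [exists y | exists x].
have [up upP] : {up : M -> M & forall x, C x -> C (up x) /\ x < up x}.
  apply: (@choice _ _ (fun x y => C x -> C y /\ x < y)) => x.
  by have [/nomax[y]|?] := pselect (C x); [exists y | exists x].
pose a := fix a n := if n is n'.+1 then up (Order.max (a n') (o n')) else o 0.
pose b := fix b n := if n is n'.+1 then dn (Order.min (b n') (o n')) else o 0.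
have Ca n : C (a n).
  by elim: n => [|n IHn] //=; apply: (proj1 (upP _ _)); case: leP.
have Cb n : C (b n).
  by elim: n => [|n IHn] //=; apply: (proj1 (dnP _ _)); case: leP.
have aS n : Order.max (a n) (o n) < a n.+1.
  by apply: (proj2 (upP _ _)); case: leP.
have bS n : b n.+1 < Order.min (b n) (o n).
  by apply: (proj2 (dnP _ _)); case: leP.
have a_lt : {homo a : i j / (i < j)%N >-> i < j}.
  by apply: homo_ltn lt_trans _ => n; have := aS n; rewrite gt_max => /andP[].
have b_lt : {homo b : i j / (j < i)%N >-> i < j}.
  move=> i j; elim: i => // i IHi; rewrite ltnS leq_eqVlt => /predU1P[->|/IHi].
    by have := bS i; rewrite lt_min => /andP[].
  by apply: lt_trans; have := bS i; rewrite lt_min => /andP[].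
pose e i := match i with Posz n => a n | Negz n => b n.+1 end.
have e_lt : {homo e : i j / i < j}.
  move=> [i|i] [j|j] ij; [by apply: a_lt; lia|by lia| |by apply: b_lt; lia].
  have bo : b i.+1 < o 0 by exact: (b_lt i.+1 0).
  by by case: j ij => [//|j] _; apply: lt_trans bo _; apply: (a_lt 0).
exists e => // x; split=> [Cx|[i [j eij]]].
  have [m omx] := o_coinit x Cx; have [n xon] := o_cofin x Cx.
  exists (Negz m), (Posz n.+1); apply/andP; split.
    by apply: lt_le_trans omx; have := bS m; rewrite lt_min => /andP[].
  by apply: le_lt_trans xon _; have := aS n; rewrite gt_max => /andP[].
have Ce k : C (e k) by case: k => k; [apply: Ca | apply: Cb].
exact: Cconv eij.
Qed.

Lemma cell_exists d (M : orderType d) (e : int -> M) (x : M) :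
  {homo e : i j / i < j} -> spanned e x -> exists i, e i <= x < e (i + 1)%R.
Proof.
move=> e_lt [i [j /andP[/ltW ix xj]]].
have [n xn] : exists n, x < e (i + Posz n)%R.
  have [ij|ji] := leP i j; first by exists `|j - i|%N; rewrite (_ : (_ + _)%R = j) //; lia.
  by exists 0; rewrite GRing.addr0 (lt_trans xj (e_lt _ _ ji)).
elim: n xn => [|n IHn] xn; first by move: xn; rewrite GRing.addr0 ltNge ix.
have [/IHn//|nx] := ltP x (e (i + Posz n)%R).
exists (i + Posz n)%R; rewrite nx /= (_ : (i + Posz n + 1)%R = (i + Posz n.+1)%R) //; lia.
Qed.

(** * Coarse isomorphisms *)

Definition flip A B (E : A -> B -> Prop) : B -> A -> Prop := fun y x => E x y.

Definition sharp A B (E : A -> B -> Prop) (x : A) (y : B) : Prop :=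
  (forall x', E x' y -> x' = x) /\ (forall y', E x y' -> y' = y).

(** An isomorphism up to convex blocks: [E x y] says that the block of [x]
corresponds to the block of [y], so that [flip E y] and [E x] are these two
blocks.  Restricting blocks to single points and spans of integer chains is what
allows blocks to be subdivided again: the latter decompose into intervals with
end points, and homogeneity identifies any two of those. *)
Record coarse_iso d1 d2 (M1 : orderType d1) (M2 : orderType d2)
    (C : M1 -> Prop) (D : M2 -> Prop) (E : M1 -> M2 -> Prop) : Prop := CoarseIso {
  ci_sub : forall x y, E x y -> C x /\ D y;
  ci_left : forall x, C x -> exists y, E x y;
  ci_right : forall y, D y -> exists x, E x y;
  ci_dif : forall x x' y y', E x y -> E x' y -> E x' y' -> E x y';
  ci_mono : forall x x' y y', E x y -> E x' y' -> x < x' -> y' <= y -> E x y';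
  ci_block : forall x y, E x y ->
    sharp E x y \/ zspan (flip E y) /\ zspan (E x) }.

Lemma coarse_iso_flip d1 d2 (M1 : orderType d1) (M2 : orderType d2)
    (C : M1 -> Prop) (D : M2 -> Prop) (E : M1 -> M2 -> Prop) :
  coarse_iso C D E -> coarse_iso D C (flip E).
Proof.
move=> [sub left right dif mono block]; split=> //.
- by move=> y x /sub[].
- by move=> y y' x x' Exy Exy' Ex'y'; apply: dif Ex'y' Exy' Exy.
- move=> y y' x x' Exy Exy' yy'; rewrite le_eqVlt => /predU1P[->//|xx'].
  exact: mono Exy' Exy xx' (ltW yy').
- by move=> y x /block[[xu yu]|[zx zy]]; [left | right].
Qed.

Lemma coarse_iso_restrict d1 d2 (M1 : orderType d1) (M2 : orderType d2)
    (C C0 : M1 -> Prop) (D D0 : M2 -> Prop) (E : M1 -> M2 -> Prop) :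
    coarse_iso C D E -> (forall x, C0 x -> C x) -> (forall y, D0 y -> D y) ->
    (forall x y, E x y -> (C0 x <-> D0 y)) ->
  coarse_iso C0 D0 (fun x y => E x y /\ C0 x).
Proof.
move=> [sub left right dif mono block] C0C D0D C0D0; split.
- by move=> x y [Exy C0x]; split; [|apply/(C0D0 _ _ Exy)].
- by move=> x C0x; have [y Exy] := left x (C0C _ C0x); exists y.
- move=> y D0y; have [x Exy] := right y (D0D _ D0y); exists x.
  by split=> //; apply/(C0D0 _ _ Exy).
- by move=> x x' y y' [Exy C0x] [Ex'y _] [Ex'y' _]; split=> //; apply: dif Exy Ex'y Ex'y'.
- by move=> x x' y y' [Exy C0x] [Ex'y' _] xx' y'y; split=> //; apply: mono Exy Ex'y' _ _.
- move=> x y [Exy C0x].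
  have eL : flip (fun x y => E x y /\ C0 x) y = flip E y.
    apply/predeqP => x'; split=> [[]//|Ex'y]; split=> //.
    by apply/(C0D0 _ _ Ex'y)/(C0D0 _ _ Exy).
  have eR : (fun y => E x y /\ C0 x) = E x.
    by apply/predeqP => y'; split=> [[]|].
  have [[xu yu]|zz] := block _ _ Exy; [left | by right; rewrite eL eR].
  by split=> [x' [/xu]|y' [/yu]].
Qed.

(** This carries a correspondence over from one interval of the target to another
one that is isomorphic to it; convexity of [D'] keeps the images of blocks
spanned by the images of their chains. *)
Lemma coarse_iso_map d1 d2 d3 (M1 : orderType d1) (M2 : orderType d2)
    (M3 : orderType d3) (C : M1 -> Prop) (D : M2 -> Prop) (D' : M3 -> Prop)
    (E : M1 -> M2 -> Prop) (k : M2 -> M3) :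
    coarse_iso C D E ->
    (forall w, D w -> D' (k w)) ->
    (forall y, D' y -> exists2 w, D w & k w = y) ->
    (forall w w', D w -> D w' -> (k w < k w') = (w < w')) ->
    (forall x y z, D' x -> D' z -> x < y < z -> D' y) ->
  coarse_iso C D' (fun x y => exists2 w, E x w & k w = y).
Proof.
move=> [sub left right dif mono block] DD' kD klt conv.
have kle w w' : D w -> D w' -> (k w <= k w') = (w <= w').
  by move=> Dw Dw'; rewrite !leNgt klt.
have kinj w w' : D w -> D w' -> k w = k w' -> w = w'.
  by move=> Dw Dw' e; apply: le_anti; rewrite -!kle // e lexx.
have DE x w : E x w -> D w by move=> /sub[].
split.
- by move=> x _ [w /sub[Cx Dw] <-]; split=> //; apply: DD'.
- by move=> x /left[w Exw]; exists (k w), w.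
- by move=> y /kD[w /right[x Exw] <-]; exists x, w.
- move=> x x' y y' [w Exw <-] [w' Ex'w' /kinj e] [v Ex'v <-]; exists v => //.
  have ew : w' = w by apply: e; [exact: DE Ex'w' | exact: DE Exw].
  by rewrite ew in Ex'w'; apply: dif Exw Ex'w' Ex'v.
- move=> x x' _ _ [w Exw <-] [w' Exw' <-] xx'.
  rewrite kle; [|exact: DE Exw'|exact: DE Exw] => ww'.
  by exists w' => //; apply: mono Exw Exw' xx' ww'.
- move=> x _ [w Exw <-].
  have fL x' : (exists2 w', E x' w' & k w' = k w) -> E x' w.
    by move=> [w' Ex'w' /kinj e]; rewrite -[w]e //; [exact: DE Ex'w' | exact: DE Exw].
  have eL : flip (fun x y => exists2 w, E x w & k w = y) (k w) = flip E w.
    by apply/predeqP => x'; split=> [/fL//|Ex'w]; exists w.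
  have [[xu wu]|[zx [e e_lt eP]]] := block _ _ Exw; [left | right].
    by split=> [x' /fL/xu//|_ [w' /wu-> <-]].
  rewrite eL; split=> //.
  have De i : D (e i) by apply: (DE x); apply/eP/spanned_mem.
  exists (k \o e) => [i j ij|y] /=; first by rewrite klt // e_lt.
  split=> [[w' Exw' <-]|[i [j /= eij]]].
    by have /eP[i [j eij]] := Exw'; exists i, j; rewrite /= !klt //; apply: DE Exw'.
  have /kD[w' Dw' kw'] : D' y by apply: conv eij; apply: DD'.
  exists w' => //; apply/eP; exists i, j; move: eij; rewrite -kw' !klt //.
Qed.

Lemma floor_le d (M : orderType d) (e : int -> M) (i j : int) (x x' : M) :
  {homo e : i j / i < j} -> e i <= x -> x' < e (j + 1)%R -> x <= x' -> i <= j.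
Proof.
move=> e_lt ix xj xx'; rewrite leNgt; apply/negP => ji.
have eji : e (j + 1)%R <= e i.
  have [->//|nji] := eqVneq (j + 1)%R i.
  by apply/ltW/e_lt; lia.
by have := lt_le_trans xj (le_trans eji (le_trans ix xx')); rewrite ltxx.
Qed.

Lemma floor_uniq d (M : orderType d) (e : int -> M) (i j : int) (x : M) :
    {homo e : i j / i < j} ->
  e i <= x < e (i + 1)%R -> e j <= x < e (j + 1)%R -> i = j.
Proof.
move=> e_lt /andP[ix xi] /andP[jx xj].
by apply: le_anti; rewrite (floor_le e_lt ix xj) // (floor_le e_lt jx xi).
Qed.

Lemma cell_floor d (M : orderType d) (e : int -> M) (i : int) (x : M) :
  cell e i x -> e i <= x < e (i + 1)%R.
Proof. by move=> /andP[/ltW-> ->]. Qed.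

(** Two integer chains are matched term by term, and the cells between
consecutive terms are filled in with given coarse isomorphisms. *)
Section Glue.
Variables (d1 d2 : Order.disp_t) (M1 : orderType d1) (M2 : orderType d2).
Variables (e1 : int -> M1) (e2 : int -> M2) (P : int -> M1 -> M2 -> Prop).
Hypotheses (e1_lt : {homo e1 : i j / i < j}) (e2_lt : {homo e2 : i j / i < j}).
Hypothesis ciP : forall i, coarse_iso (cell e1 i) (cell e2 i) (P i).

Definition glue (x : M1) (y : M2) : Prop :=
  exists i, x = e1 i /\ y = e2 i \/ P i x y.

Let point_floor d (M : orderType d) (e : int -> M) (i : int) :
  {homo e : i j / i < j} -> e i <= e i < e (i + 1)%R.
Proof. by move=> e_lt; rewrite lexx e_lt //; lia. Qed.

Lemma glue_point_left i y : glue (e1 i) y -> y = e2 i.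
Proof.
move=> [j [[e ->]|/(ci_sub (ciP j))[cj _]]].
  have <-// : i = j by apply: (floor_uniq e1_lt (point_floor i e1_lt)); rewrite e point_floor.
have ij := floor_uniq e1_lt (point_floor i e1_lt) (cell_floor cj).
by move: cj; rewrite /cell ij ltxx.
Qed.

Lemma glue_point_right i x : glue x (e2 i) -> x = e1 i.
Proof.
move=> [j [[-> e]|/(ci_sub (ciP j))[_ cj]]].
  have <-// : i = j by apply: (floor_uniq e2_lt (point_floor i e2_lt)); rewrite e point_floor.
have ij := floor_uniq e2_lt (point_floor i e2_lt) (cell_floor cj).
by move: cj; rewrite /cell ij ltxx.
Qed.

Lemma glue_cell_left i x y : cell e1 i x -> glue x y -> P i x y.
Proof.
move=> ci [j [[e _]|Pxy]].
  have ij : i = j by apply: (floor_uniq e1_lt (cell_floor ci)); rewrite e point_floor.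
  by move: ci; rewrite /cell e ij ltxx.
have [cj _] := ci_sub (ciP j) Pxy.
by rewrite (floor_uniq e1_lt (cell_floor ci) (cell_floor cj)).
Qed.

Lemma glue_cell_right i x y : cell e2 i y -> glue x y -> P i x y.
Proof.
move=> ci [j [[_ e]|Pxy]].
  have ij : i = j by apply: (floor_uniq e2_lt (cell_floor ci)); rewrite e point_floor.
  by move: ci; rewrite /cell e ij ltxx.
have [_ cj] := ci_sub (ciP j) Pxy.
by rewrite (floor_uniq e2_lt (cell_floor ci) (cell_floor cj)).
Qed.

Lemma glue_sharp i x y : P i x y -> sharp (P i) x y -> sharp glue x y.
Proof.
move=> Pxy [xu yu]; have [cx cy] := ci_sub (ciP i) Pxy.
by split=> [x' /(glue_cell_right cy)/xu|y' /(glue_cell_left cx)/yu].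
Qed.

Lemma glue_point_sharp i : sharp glue (e1 i) (e2 i).
Proof. by split=> [x /glue_point_right|y /glue_point_left]. Qed.

Lemma coarse_iso_glue : coarse_iso (spanned e1) (spanned e2) glue.
Proof.
have cell_span d (M : orderType d) (e : int -> M) i x : cell e i x -> spanned e x.
  by exists i, (i + 1)%R.
split.
- move=> x y [i [[-> ->]|/(ci_sub (ciP i))[cx cy]]]; first by split; apply: spanned_mem.
  by split; apply: cell_span; eauto.
- move=> x /(cell_exists e1_lt)[i /andP[]]; rewrite le_eqVlt => /predU1P[<- _|ix xi].
    by exists (e2 i), i; left.
  have /(ci_left (ciP i))[y Pxy] : cell e1 i x by rewrite /cell ix.
  by exists y, i; right.
- move=> y /(cell_exists e2_lt)[i /andP[]]; rewrite le_eqVlt => /predU1P[<- _|iy yi].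
    by exists (e1 i), i; left.
  have /(ci_right (ciP i))[x Pxy] : cell e2 i y by rewrite /cell iy.
  by exists x, i; right.
- move=> x x' y y' [i [[-> ->] /glue_point_right-> //|Pxy]].
  have [cx cy] := ci_sub (ciP i) Pxy.
  move=> /(glue_cell_right cy) Px'y; have [cx' _] := ci_sub (ciP i) Px'y.
  move=> /(glue_cell_left cx') Px'y'; exists i; right.
  exact: ci_dif (ciP i) _ _ _ _ Pxy Px'y Px'y'.
- have floors x y : glue x y -> exists i, [/\ e1 i <= x < e1 (i + 1)%R,
      e2 i <= y < e2 (i + 1)%R & x = e1 i /\ y = e2 i \/ P i x y].
    move=> [i [[-> ->]|Pxy]]; exists i; first by rewrite !point_floor //; split=> //; left.
    by have [cx cy] := ci_sub (ciP i) Pxy; rewrite !cell_floor //; split=> //; right.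
  move=> x x' y y' /floors[i [/andP[ix xi] /andP[iy yi] Gi]].
  move=> /floors[j [/andP[jx xj] /andP[jy yj] Gj]] xx' y'y.
  have eij : i = j.
    by apply: le_anti; rewrite (floor_le e1_lt ix xj (ltW xx')) (floor_le e2_lt jy yi y'y).
  subst j; case: Gj => [[ex' _]|Px'y']; first by move: xx'; rewrite ex' ltNge ix.
  have [_ /andP[iy' _]] := ci_sub (ciP i) Px'y'.
  case: Gi => [[_ ey]|Pxy]; first by move: y'y; rewrite ey leNgt iy'.
  by exists i; right; apply: ci_mono (ciP i) _ _ _ _ Pxy Px'y' xx' y'y.
- move=> x y [i [[-> ->]|Pxy]]; first by left; apply: glue_point_sharp.
  have [cx cy] := ci_sub (ciP i) Pxy.
  have [xy|[zx zy]] := ci_block (ciP i) Pxy; first by left; apply: glue_sharp Pxy xy.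
  have -> : glue x = P i x.
    by apply/predeqP => y'; split=> [/(glue_cell_left cx)//|]; exists i; right.
  have -> : flip glue y = flip (P i) y.
    by apply/predeqP => x'; split=> [/(glue_cell_right cy)//|]; exists i; right.
  by right.
Qed.

End Glue.

(** Each pair of corresponding blocks is subdivided by a coarse isomorphism which
depends on the blocks only, not on the points [x] and [y] that represent them;
hence [S] takes the blocks, as predicates, for arguments. *)
Section Refine.
Variables (d1 d2 : Order.disp_t) (M1 : orderType d1) (M2 : orderType d2).
Variables (C : M1 -> Prop) (D : M2 -> Prop) (E : M1 -> M2 -> Prop).
Variable S : (M1 -> Prop) -> (M2 -> Prop) -> M1 -> M2 -> Prop.
Hypothesis ciE : coarse_iso C D E.
Hypothesis ciS : forall x y, E x y -> coarse_iso (flip E y) (E x) (S (flip E y) (E x)).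

Lemma block_right_eq x x' y : E x y -> E x' y -> E x' = E x.
Proof.
move=> Exy Ex'y; apply/predeqP => z.
by split; [apply: ci_dif ciE _ _ _ _ Exy Ex'y | apply: ci_dif ciE _ _ _ _ Ex'y Exy].
Qed.

Lemma block_left_eq x y y' : E x y -> E x y' -> flip E y' = flip E y.
Proof.
move=> Exy Exy'; apply/predeqP => z; rewrite /flip.
by split=> Ez; [apply: ci_dif ciE _ _ _ _ Ez Exy' Exy | apply: ci_dif ciE _ _ _ _ Ez Exy Exy'].
Qed.

Lemma coarse_iso_refine :
  coarse_iso C D (fun x y => E x y /\ S (flip E y) (E x) x y).
Proof.
have eqR := block_right_eq; have eqL := block_left_eq.
split.
- by move=> x y [/(ci_sub ciE)].
- move=> x /(ci_left ciE)[y Exy]; have [y' Sxy'] := ci_left (ciS Exy) Exy.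
  have [_ Exy'] := ci_sub (ciS Exy) Sxy'.
  by exists y'; rewrite (eqL _ _ _ Exy Exy').
- move=> y /(ci_right ciE)[x Exy]; have [x' Sx'y] := ci_right (ciS Exy) Exy.
  have [Ex'y _] := ci_sub (ciS Exy) Sx'y.
  by exists x'; rewrite (eqR _ _ _ Exy Ex'y).
- move=> x x' y y' [Exy Sxy] [Ex'y Sx'y] [Ex'y' Sx'y'].
  have Exy' := ci_dif ciE Exy Ex'y Ex'y'; split=> //.
  rewrite (eqR _ _ _ Exy Ex'y) in Sx'y Sx'y'.
  rewrite (eqL _ _ _ Exy Exy') in Sx'y' *.
  exact: ci_dif (ciS Exy) _ _ _ _ Sxy Sx'y Sx'y'.
- move=> x x' y y' [Exy Sxy] [Ex'y' Sx'y'] xx' y'y.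
  have Exy' := ci_mono ciE Exy Ex'y' xx' y'y; split=> //.
  rewrite (eqR _ _ _ Exy' Ex'y') (eqL _ _ _ Exy Exy') in Sx'y' *.
  exact: ci_mono (ciS Exy) _ _ _ _ Sxy Sx'y' xx' y'y.
- move=> x y [Exy Sxy].
  have -> : (fun y0 => E x y0 /\ S (flip E y0) (E x) x y0) = S (flip E y) (E x) x.
    apply/predeqP => y'; split=> [[Exy']|Sxy']; first by rewrite (eqL _ _ _ Exy Exy').
    by have [_ Exy'] := ci_sub (ciS Exy) Sxy'; rewrite (eqL _ _ _ Exy Exy').
  have eL : flip (fun x y => E x y /\ S (flip E y) (E x) x y) y
           = flip (S (flip E y) (E x)) y.
    apply/predeqP => x'; split=> [[Ex'y]|Sx'y]; first by rewrite (eqR _ _ _ Exy Ex'y).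
    have [Ex'y _] := ci_sub (ciS Exy) Sx'y; split=> //.
    by rewrite (eqR _ _ _ Exy Ex'y).
  rewrite eL; have [xy|zz] := ci_block (ciS Exy) Sxy; [left | by right].
  have [xu yu] := xy; split=> [x' [Ex'y]|y' [Exy']].
    by rewrite (eqR _ _ _ Exy Ex'y) => /xu.
  by rewrite (eqL _ _ _ Exy Exy') => /yu.
Qed.

End Refine.

(** The intersection of a decreasing sequence is an isomorphism once every point
of either side eventually is a block of its own.  Isolating the points of [M1]
alone would not do: blocks around a point of [M2] could shrink to it while their
counterparts shrink to a gap of [M1]. *)
Lemma coarse_iso_limit d1 d2 (M1 : orderType d1) (M2 : orderType d2)
    (E : nat -> M1 -> M2 -> Prop) :
    (forall n, coarse_iso (fun=> True) (fun=> True) (E n)) ->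
    (forall n x y, E n.+1 x y -> E n x y) ->
    (forall x, exists n, forall y, E n x y -> sharp (E n) x y) ->
    (forall y, exists n, forall x, E n x y -> sharp (E n) x y) ->
  order_iso M1 M2.
Proof.
move=> ciE decE sharpL sharpR.
have dec m n x y : (m <= n)%N -> E n x y -> E m x y.
  by move=> /subnK <-; elim: (n - m)%N => // k IHk /decE/IHk.
have lim n x y : E n x y -> sharp (E n) x y ->
    (forall m, E m x y).
  move=> Exy [xu yu] m; have [mn|nm] := leqP m n; first exact: dec Exy.
  have [y' Exy'] := ci_left (ciE m) (x := x) I.
  by rewrite -(yu y') //; apply: dec (ltnW nm) Exy'.
have [f fP] : {f : M1 -> M2 & forall x n, E n x (f x)}.
  apply: (@choice _ _ (fun x y => forall n, E n x y)) => x; have [n xn] := sharpL x.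
  by have [y Exy] := ci_left (ciE n) (x := x) I; exists y; apply: lim (Exy) (xn _ Exy).
have [g gP] : {g : M2 -> M1 & forall y n, E n (g y) y}.
  apply: (@choice _ _ (fun y x => forall n, E n x y)) => y; have [n yn] := sharpR y.
  by have [x Exy] := ci_right (ciE n) (y := y) I; exists x; apply: lim (Exy) (yn _ Exy).
have fK : cancel f g.
  move=> x; have [n xn] := sharpL x.
  by have [xu _] := xn _ (fP x n); apply: xu; apply: gP.
have gK : cancel g f.
  move=> y; have [n yn] := sharpR y.
  by have [_ yu] := yn _ (gP y n); apply: yu; apply: fP.
have f_lt : {homo f : x x' / x < x'}.
  move=> x x' xx'; rewrite ltNge; apply/negP => fxx'.
  have [n xn] := sharpL x.
  have [_ yu] := xn _ (fP x n).
  have e : f x' = f x by apply/yu/(ci_mono (ciE n) (fP x n) (fP x' n) xx' fxx').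
  by have := lt_irreflexive x; rewrite -{2}(fK x) -e fK xx'.
exists f; first by exists g.
by apply: leW_mono; apply: le_mono.
Qed.

(** * Blocks of points that a condition does not separate *)

(** What a condition [s] knows about an isomorphism that is only forced to
exist: [F s x y] says that [s] decides the value at [x] to be [y].  Values at
incompatible conditions are unrelated. *)
Record approximation (T : Type) (le : T -> T -> Prop) d1 d2
    (M1 : orderType d1) (M2 : orderType d2) (F : T -> M1 -> M2 -> Prop) : Prop :=
  Approximation {
    ap_refl : forall s, le s s;
    ap_trans : forall t s r, le r t -> le t s -> le r s;
    ap_mono : forall s t x y, le t s -> F s x y -> F t x y;
    ap_left : forall s x, exists t y, le t s /\ F t x y;
    ap_right : forall s y, exists t x, le t s /\ F t x y;
    ap_lt : forall s x y x' y', F s x y -> F s x' y' -> (x < x') = (y < y') }.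

Lemma approximation_flip (T : Type) (le : T -> T -> Prop) d1 d2
    (M1 : orderType d1) (M2 : orderType d2) (F : T -> M1 -> M2 -> Prop) :
  approximation le F -> approximation le (fun s => flip (F s)).
Proof.
move=> [refl trans mono left right lt]; split=> //.
- by move=> s t y x; apply: mono.
- by move=> s y x y' x' Fs Fs'; rewrite (lt _ _ _ _ _ Fs Fs').
Qed.

Section Decided.
Variables (T : countType) (le : T -> T -> Prop).
Variables (d1 d2 : Order.disp_t) (M1 : orderType d1) (M2 : orderType d2).
Variable F : T -> M1 -> M2 -> Prop.
Hypothesis apF : approximation le F.

Let mono := ap_mono apF.
Let refl := ap_refl apF.
Let trans := ap_trans apF.

Lemma ap_funct s x y y' : F s x y -> F s x y' -> y = y'.
Proof.
move=> Fy Fy'; apply: le_anti; rewrite !leNgt.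
by rewrite -(ap_lt apF Fy Fy') -(ap_lt apF Fy' Fy) ltxx.
Qed.

Lemma ap_inj s x x' y : F s x y -> F s x' y -> x = x'.
Proof.
move=> Fx Fx'; apply: le_anti; rewrite !leNgt.
by rewrite (ap_lt apF Fx Fx') (ap_lt apF Fx' Fx) ltxx.
Qed.

Lemma ap_le s x y x' y' : F s x y -> F s x' y' -> (x <= x') = (y <= y').
Proof. by move=> Fs Fs'; rewrite !leNgt (ap_lt apF Fs' Fs). Qed.

(** The condition [s] forces that the isomorphism maps [L] onto [L']: no condition
below [s] decides a value that crosses the cut.  A cut at a gap can be decided by
an [s] that decides no value nearby. *)
Definition decided_cut s (L : M1 -> Prop) (L' : M2 -> Prop) : Prop :=
  [/\ forall x x', x' < x -> L x -> L x', forall y y', y' < y -> L' y -> L' y' &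
      forall t x y, le t s -> F t x y -> (L x <-> L' y)].

Definition unseparated s (x : M1) (y : M2) : Prop :=
  forall L L', decided_cut s L L' -> (L x <-> L' y).

Lemma F_unseparated s t x y : le t s -> F t x y -> unseparated s x y.
Proof. by move=> ts Ft L L' [_ _ /(_ _ _ _ ts Ft)]. Qed.

(** The value is decided by densely many conditions below [s]; such pairs are the
one-point blocks. *)
Definition settled s (x : M1) (y : M2) : Prop :=
  forall t, le t s -> exists2 r, le r t & F r x y.

Lemma F_settled s x y : F s x y -> settled s x y.
Proof. by move=> Fs t ts; exists t; [apply: refl | apply: mono ts Fs]. Qed.

Lemma settled_unseparated s x y : settled s x y -> unseparated s x y.
Proof. by move=> /(_ s (refl s))[t ts Ft]; apply: F_unseparated ts Ft. Qed.

Lemma decided_cut_lt s a b :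
  settled s a b -> decided_cut s (fun x => x < a) (fun y => y < b).
Proof.
move=> ab; split=> [x x'|y y'|t x y ts Ft]; [exact: lt_trans.. |].
by have [r rt Fr] := ab t ts; rewrite (ap_lt apF (mono rt Ft) Fr).
Qed.

Lemma decided_cut_le s a b :
  settled s a b -> decided_cut s (fun x => x <= a) (fun y => y <= b).
Proof.
move=> ab; split=> [x x' /ltW|y y' /ltW|t x y ts Ft]; [exact: le_trans.. |].
by have [r rt Fr] := ab t ts; rewrite (ap_le (mono rt Ft) Fr).
Qed.

Lemma settled_lt s a b x y :
  settled s a b -> unseparated s x y -> ((x < a) = (y < b)) * ((a < x) = (b < y)).
Proof.
move=> ab xy; split; first by apply/idP/idP => /(xy _ _ (decided_cut_lt ab)).
by rewrite !ltNge; congr negb; apply/idP/idP => /(xy _ _ (decided_cut_le ab)).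
Qed.

Lemma settled_sharp s a b : settled s a b -> sharp (unseparated s) a b.
Proof.
move=> ab; split=> [x xb|y ay]; apply: le_anti.
  by rewrite !leNgt !(settled_lt ab xb) ltxx.
by rewrite !leNgt -!(settled_lt ab ay) ltxx.
Qed.

Lemma unseparated_dif s x x' y y' :
  unseparated s x y -> unseparated s x' y -> unseparated s x' y' ->
  unseparated s x y'.
Proof.
move=> xy x'y x'y' L L' cL.
by split=> [/(xy _ _ cL)/(x'y _ _ cL)/(x'y' _ _ cL)|/(x'y' _ _ cL)/(x'y _ _ cL)/(xy _ _ cL)].
Qed.

(** The block of [x] is the convex hull of the orbit of [x] under the moves [next]
from a point to one of its possible values and on to a possible argument for that
value.  Indeed the orbit lies in the block, and the points below (or above) all of
the orbit form one side of a decided cut.  The orbit is indexed by finite sequences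
of pairs of conditions, so it is countable.  No end points exist: a point without
settled value has two possible values, and the one argument that another condition
gives to the larger (smaller) value lies above (below) the point. *)
Lemma unseparated_zspan s x y : unseparated s x y ->
    (forall a b, unseparated s a y -> ~ settled s a b) ->
  zspan (flip (unseparated s) y).
Proof.
move=> xy nosettle.
have [next nextP] : {next : M1 -> T * T -> M1 & forall x tt',
    (forall y x', le tt'.1 s -> le tt'.2 s -> F tt'.1 x y -> F tt'.2 x' y ->
       next x tt' = x') /\
    (forall w, unseparated s x w -> unseparated s (next x tt') w)}.
  suff /choice[f fP] : forall p : M1 * (T * T), exists a',
      (forall y x', le p.2.1 s -> le p.2.2 s -> F p.2.1 p.1 y -> F p.2.2 x' y ->
         a' = x') /\
      (forall w, unseparated s p.1 w -> unseparated s a' w).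
    by exists (fun x tt' => f (x, tt')) => a tt'; apply: (fP (a, tt')).
  move=> [a [t t']] /=.
  have [[b [a' [ts t's Fab Fa'b]]]|none] :=
    pselect (exists b a', [/\ le t s, le t' s, F t a b & F t' a' b]).
    exists a'; split=> [b' a'' _ _ Fab' Fa''b'|w aw].
      by rewrite -(ap_funct Fab Fab') in Fa''b'; apply: ap_inj Fa'b Fa''b'.
    exact: unseparated_dif (F_unseparated t's Fa'b) (F_unseparated ts Fab) aw.
  exists a; split=> // b a' ts t's Fab Fa'b; case: none.
  by exists b, a'.
pose o n := foldl next x (odflt [::] (unpickle n)).
have oE l : exists n, o n = foldl next x l.
  by exists (pickle l); rewrite /o pickleK.
have o_step n t t' b a : le t s -> le t' s -> F t (o n) b -> F t' a b ->
    exists m, o m = a.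
  move=> ts t's Fb Fa; have [m om] := oE (rcons (odflt [::] (unpickle n)) (t, t')).
  have [next_eq _] := nextP (o n) (t, t').
  by exists m; rewrite om foldl_rcons; apply: next_eq ts t's Fb Fa.
have o_block n : unseparated s (o n) y.
  rewrite /o; elim/last_ind: (odflt _ _) => //= l tt' IHl; rewrite foldl_rcons.
  by have [_ next_block] := nextP (foldl next x l) tt'; apply: next_block.
have [n0 o0] : exists n, o n = x by have := oE [::].
apply: (@zspan_countable _ _ _ o) => //.
- move=> a b c ay cy /andP[ab bc] L L' cL; have [downL _ _] := cL.
  split=> [Lb|L'y]; first by apply/(ay _ _ cL)/(downL b).
  by apply: (downL c) => //; apply/(cy _ _ cL).
- move=> z zy; apply: contrapT => noo.
  have zo n : z < o n by rewrite ltNge; apply/negP => ozn; apply: noo; exists n.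
  pose L a := forall n, a < o n.
  pose L' b := forall n t c, le t s -> F t (o n) c -> b < c.
  have cL : decided_cut s L L'.
    split=> [a a' aa' La n|b b' bb' L'b n t c ts Fc|t a b ts Fab].
    - exact: lt_trans aa' (La n).
    - exact: lt_trans bb' (L'b n t c ts Fc).
    - split=> [La n t' c t's Fc|L'b n].
        have [r [a' [rt Fa'c]]] := ap_right apF t c.
        have [m om] := o_step _ _ _ _ _ t's (trans rt ts) Fc Fa'c.
        by rewrite -(ap_lt apF (mono rt Fab) Fa'c) -om; apply: La.
      have [r [c [rt Fc]]] := ap_left apF t (o n).
      rewrite (ap_lt apF (mono rt Fab) Fc).
      exact: L'b (trans rt ts) Fc.
  have /(_ n0) : L x by apply/(xy _ _ cL)/(zy _ _ cL).
  by rewrite o0 ltxx.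
- move=> z zy.
  pose L a := exists n, a <= o n.
  pose L' b := exists n t c, [/\ le t s, F t (o n) c & b <= c].
  have cL : decided_cut s L L'.
    split=> [a a' aa' [n an]|b b' bb' [n [t [c [ts Fc bc]]]]|t a b ts Fab].
    - by exists n; apply: le_trans (ltW aa') an.
    - by exists n, t, c; rewrite (le_trans (ltW bb') bc).
    - split=> [[n an]|[n [t' [c [t's Fc bc]]]]].
        have [r [c [rt Fc]]] := ap_left apF t (o n).
        exists n, r, c; rewrite -(ap_le (mono rt Fab) Fc).
        by split=> //; apply: trans rt ts.
      have [r [a' [rt Fa'c]]] := ap_right apF t c.
      have [m om] := o_step _ _ _ _ _ t's (trans rt ts) Fc Fa'c.
      by exists m; rewrite om (ap_le (mono rt Fab) Fa'c).
  by apply/(zy _ _ cL)/(xy _ _ cL); exists n0; rewrite o0.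
(* Two values [b1], [b2] are possible for [a]; the conditions that provide [b2] as a
   value of [a2], resp. [b1] as a value of [a1], still know that [a] goes to [b1],
   resp. [b2], so that [a1], [a], [a2] are in the order of [b1], [b2]. *)
all: move=> a ay.
all: have [t [b1 [ts Fb1]]] := ap_left apF s a.
all: have /existsNP[t' /not_implyP[t's nor]] := nosettle a b1 ay.
all: have [r [b2 [rt' Fb2]]] := ap_left apF t' a.
all: have rs := trans rt' t's.
all: have [t1 [a2 [t1t Fa2]]] := ap_right apF t b2.
all: have [r1 [a1 [r1r Fa1]]] := ap_right apF r b1.
all: have a2y : unseparated s a2 y
  by apply: unseparated_dif (F_unseparated (trans t1t ts) Fa2) (F_unseparated rs Fb2) ay.
all: have a1y : unseparated s a1 y
  by apply: unseparated_dif (F_unseparated (trans r1r rs) Fa1) (F_unseparated ts Fb1) ay.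
all: have /lt_total/orP[b12|b21] : b1 != b2
  by apply: contra_notN nor => /eqP b12; exists r; rewrite ?b12.
- by exists a1; rewrite (ap_lt apF Fa1 (mono r1r Fb2)).
- by exists a2; rewrite (ap_lt apF Fa2 (mono t1t Fb1)).
- by exists a2; rewrite (ap_lt apF (mono t1t Fb1) Fa2).
- by exists a1; rewrite (ap_lt apF (mono r1r Fb2) Fa1).
Qed.

End Decided.

Lemma unseparated_flip (T : countType) (le : T -> T -> Prop) d1 d2
    (M1 : orderType d1) (M2 : orderType d2) (F : T -> M1 -> M2 -> Prop) s :
  unseparated le (fun s => flip (F s)) s = flip (unseparated le F s).
Proof.
have swap L L' : decided_cut le F s L L' <-> decided_cut le (fun s => flip (F s)) s L' L.
  by split=> -[down down' dec]; split=> // t x y ts Ft; split=> /(dec _ _ _ ts Ft).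
apply/funext => y; apply/predeqP => x.
by split=> yx L L' /swap cL; split=> /(yx _ _ cL).
Qed.

Section Blocks.
Variables (T : countType) (le : T -> T -> Prop).
Variables (d1 d2 : Order.disp_t) (M1 : orderType d1) (M2 : orderType d2).
Variable F : T -> M1 -> M2 -> Prop.
Hypothesis apF : approximation le F.

(** A block with a settled pair is a single point, and all other blocks are spanned
by integer chains; the order on blocks is inherited because cuts are downward
closed. *)
Lemma coarse_iso_unseparated s :
  coarse_iso (fun=> True) (fun=> True) (unseparated le F s).
Proof.
split=> //.
- move=> x _; have [t [y [ts Ft]]] := ap_left apF s x.
  by exists y; apply: F_unseparated ts Ft.
- move=> y _; have [t [x [ts Ft]]] := ap_right apF s y.
  by exists x; apply: F_unseparated ts Ft.
- exact: unseparated_dif.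
- move=> x x' y y' xy x'y' xx' y'y L L' cL; have [downL downL' _] := cL.
  split=> [/(xy _ _ cL)|/(x'y' _ _ cL)/downL]; last exact.
  by move: y'y; rewrite le_eqVlt => /predU1P[->//|/downL']; apply.
move=> x y xy.
have [[a [b [ay ab]]]|none] :=
    pselect (exists a b, unseparated le F s a y /\ settled le F s a b).
  have [au bu] := settled_sharp apF ab; left.
  have yb := bu _ ay; rewrite yb in xy *.
  by have -> := au _ xy.
right; split.
  by apply: (unseparated_zspan apF xy) => a b ay ab; apply: none; exists a, b.
have := @unseparated_zspan _ _ _ _ _ _ _ (approximation_flip apF) s y x.
rewrite unseparated_flip; apply=> // b a xb ba; apply: none; exists a, b; split=> //.
exact: unseparated_dif (settled_unseparated apF ba) xb xy.
Qed.

End Blocks.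

(** * Isolating the points whose value a condition decides *)

Lemma homogeneous_intervals d (M : orderType d) (a b a' b' : M) :
    homogeneous_order M -> a < b -> a' < b' ->
  exists k : M -> M, [/\ forall w, a < w < b -> a' < k w < b',
    forall y, a' < y < b' -> exists2 w, a < w < b & k w = y &
    forall w w', a < w < b -> a < w' < b -> (k w < k w') = (w < w')].
Proof.
move=> hM ab ab'.
have [f f_bij f_lt] := ho_interval hM (ho_dense hM ab).
have [g [g' gK g'K] g_lt] := ho_interval hM (ho_dense hM ab').
have g'_lt x y : (sval (g' x) < sval (g' y)) = (x < y).
  by have := g_lt (g' x) (g' y); rewrite !g'K.
pose k w := if pselect (a < w < b) is left h then sval (g' (f (exist _ w h))) else w.
have kE w (h : a < w < b) : k w = sval (g' (f (exist _ w h))).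
  by rewrite /k; case: pselect => // h'; rewrite (bool_irrelevance h h').
exists k; split=> [w h|y h|w w' h h'].
- by rewrite (kE w h); exact: (svalP (g' _)).
- have [f' _ f'K] := f_bij; case e: (f' (g (exist _ y h))) => [w hw].
  by exists w; rewrite // (kE w hw) -e f'K gK.
- by rewrite (kE w h) (kE w' h') g'_lt f_lt.
Qed.

(** A span of an integer chain has more than one point, so it suffices to see that
one of the two blocks is a single point. *)
Lemma sharp_of_right_uniq d1 d2 (M1 : orderType d1) (M2 : orderType d2)
    (C : M1 -> Prop) (D : M2 -> Prop) (E : M1 -> M2 -> Prop) x y :
  coarse_iso C D E -> E x y -> (forall y', E x y' -> y' = y) -> sharp E x y.
Proof.
move=> ciE Exy yu; have [//|[_ [e e_lt eP]]] := ci_block ciE Exy.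
have ey i : e i = y by apply/yu/eP/spanned_mem.
by have := e_lt 0%R 1%R isT; rewrite !ey ltxx.
Qed.

Lemma coarse_iso_singleton d1 d2 (M1 : orderType d1) (M2 : orderType d2)
    (C : M1 -> Prop) (D : M2 -> Prop) x y :
    (forall x', C x' <-> x' = x) -> (forall y', D y' <-> y' = y) ->
  coarse_iso C D (fun x' y' => x' = x /\ y' = y).
Proof.
move=> Cx Dy; split.
- by move=> x' y' [-> ->]; split; [apply/Cx | apply/Dy].
- by move=> x' /Cx->; exists y.
- by move=> y' /Dy->; exists x.
- by move=> x1 x2 y1 y2 [-> _] _ [_ ->].
- by move=> x1 x2 y1 y2 [-> _] [_ ->].
- by move=> x' y' [-> ->]; left; split=> [z []|z []].
Qed.

Section Sharpen.
Variables (T : countType) (le : T -> T -> Prop).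

Section OneSide.
Variables (d1 d2 : Order.disp_t) (M1 : orderType d1) (M2 : orderType d2).
Variable F : T -> M1 -> M2 -> Prop.
Hypotheses (apF : approximation le F) (hM2 : homogeneous_order M2).

Definition sharpens t (E : M1 -> M2 -> Prop) : Prop :=
  forall x y w, F t x w -> E x y -> sharp E x y.

(** The values [b] and [b'] of the end points under some [s] below [t] are chosen
freely; the blocks of [s] match [(a, a')] with [(b, b')], and homogeneity of [M2]
brings [(b, b')] to the prescribed interval [(c, c')]. *)
Lemma coarse_iso_interval t a a' c c' : a < a' -> c < c' ->
  exists2 P, coarse_iso (fun x => a < x < a') (fun y => c < y < c') P &
             sharpens t P.
Proof.
move=> aa' cc'.
have [s1 [b [s1t Fb]]] := ap_left apF t a.
have [s [b' [ss1 Fb']]] := ap_left apF s1 a'.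
have {}Fb := ap_mono apF ss1 Fb; have st := ap_trans apF ss1 s1t.
have bb' : b < b' by rewrite -(ap_lt apF Fb Fb').
have [k [kin kD klt]] := homogeneous_intervals hM2 bb' cc'.
pose U x w := unseparated le F s x w /\ a < x < a'.
have ciU : coarse_iso (fun x => a < x < a') (fun w => b < w < b') U.
  apply: (coarse_iso_restrict (coarse_iso_unseparated apF s)) => // x w xw.
  by rewrite (settled_lt apF (F_settled apF Fb) xw) (settled_lt apF (F_settled apF Fb') xw).
have conv x y z : c < x < c' -> c < z < c' -> x < y < z -> c < y < c'.
  by move=> /andP[cx _] /andP[_ zc'] /andP[xy yz]; rewrite (lt_trans cx) // (lt_trans yz).
have ciP := coarse_iso_map (D' := fun y => c < y < c') ciU kin kD klt conv.
exists (fun x y => exists2 w, U x w & k w = y) => // x y w Fw Pxy.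
have [_ wu] := settled_sharp apF (F_settled apF (ap_mono apF st Fw)).
apply: (sharp_of_right_uniq ciP Pxy) => y'.
by case: Pxy => w1 [/wu-> _] <- [w2 [/wu-> _] <-].
Qed.

Lemma coarse_iso_zspan t C D : zspan C -> zspan D ->
  exists2 E, coarse_iso C D E & sharpens t E.
Proof.
move=> [e1 e1_lt /predeqP->] [e2 e2_lt /predeqP->].
have /choice[P PP] : forall i, exists P,
    coarse_iso (cell e1 i) (cell e2 i) P /\ sharpens t P.
  move=> i; have [||P ciP shP] :=
    @coarse_iso_interval t (e1 i) (e1 (i + 1)%R) (e2 i) (e2 (i + 1)%R).
  - by apply: e1_lt; lia.
  - by apply: e2_lt; lia.
  by exists P.
have ciP i : coarse_iso (cell e1 i) (cell e2 i) (P i) by case: (PP i).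
exists (glue e1 e2 P); first exact: coarse_iso_glue.
move=> x y w Fw [i [[-> ->]|Pxy]]; first exact: glue_point_sharp.
by have [_ shP] := PP i; apply: (glue_sharp e1_lt e2_lt ciP Pxy); apply: shP Fw Pxy.
Qed.

Lemma coarse_iso_sharpen t E : coarse_iso (fun=> True) (fun=> True) E ->
  exists E', [/\ coarse_iso (fun=> True) (fun=> True) E',
                 forall x y, E' x y -> E x y & sharpens t E'].
Proof.
move=> ciE.
have /choice[S' S'P] : forall CD : (M1 -> Prop) * (M2 -> Prop), exists S,
    (exists x y, E x y /\ CD = (flip E y, E x)) ->
    coarse_iso CD.1 CD.2 S /\ sharpens t S.
  move=> CD.
  have [[x [y [Exy ->]]]|none] := pselect (exists x y, E x y /\ CD = (flip E y, E x)).
    have [[xu yu]|[zx zy]] := ci_block ciE Exy.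
      exists (fun x' y' => x' = x /\ y' = y) => _; split=> /=.

        by apply: coarse_iso_singleton => z; split=> [|->] //; [apply: xu | apply: yu].
      by move=> x' y' w _ [-> ->]; split=> z [].
    by have [S' ciS' shS'] := coarse_iso_zspan t zx zy; exists S'.
  by exists (fun _ _ => True) => /none.
have SP x y : E x y -> coarse_iso (flip E y) (E x) (S' (flip E y, E x)) /\
    sharpens t (S' (flip E y, E x)).
  by move=> Exy; apply: (S'P (flip E y, E x)); exists x, y.
have ciE' : coarse_iso (fun=> True) (fun=> True)
    (fun x y => E x y /\ S' (flip E y, E x) x y).
  by apply: (coarse_iso_refine (S := fun C D => S' (C, D))) => // x y /SP[].
exists (fun x y => E x y /\ S' (flip E y, E x) x y); split=> // [x y []//|].
move=> x y w Fw Exy'; have [Exy Sxy] := Exy'.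
apply: (sharp_of_right_uniq ciE' Exy') => y' [Ey' Sy'].
have [_ shS] := SP _ _ Exy; have [_ yu] := shS _ _ _ Fw Sxy.
by apply: yu; rewrite -(block_left_eq ciE Exy Ey').
Qed.

End OneSide.
End Sharpen.

Lemma sharp_sub A B (E E' : A -> B -> Prop) x y :
  (forall x y, E' x y -> E x y) -> sharp E x y -> sharp E' x y.
Proof. by move=> sub [xu yu]; split=> [x' /sub/xu|y' /sub/yu]. Qed.

Lemma sharp_flip A B (E : A -> B -> Prop) x y : sharp (flip E) y x -> sharp E x y.
Proof. by case. Qed.

Lemma coarse_iso_sharpen_both (T : countType) (le : T -> T -> Prop) d1 d2
    (M1 : orderType d1) (M2 : orderType d2) (F : T -> M1 -> M2 -> Prop) t E :
    approximation le F -> homogeneous_order M1 -> homogeneous_order M2 ->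
    coarse_iso (fun=> True) (fun=> True) E ->
  exists E', [/\ coarse_iso (fun=> True) (fun=> True) E',
    forall x y, E' x y -> E x y,
    sharpens F t E' & sharpens (fun s => flip (F s)) t (flip E')].
Proof.
move=> apF hM1 hM2 ciE.
have [E1 [ciE1 sub1 shE1]] := coarse_iso_sharpen apF hM2 t ciE.
have [E2 [ciE2 sub2 shE2]] :=
  coarse_iso_sharpen (approximation_flip apF) hM1 t (coarse_iso_flip ciE1).
exists (flip E2); split=> //; first exact: coarse_iso_flip ciE2.
  by move=> x y /sub2/sub1.
move=> x y w Fw Exy.
by apply: sharp_sub (shE1 _ _ _ Fw (sub2 _ _ Exy)) => x' y' /sub2.
Qed.

(** The conditions are enumerated and treated one at each step; a point is isolated
at the step of any condition that decides its value or argument. *)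
Theorem approximation_iso (T : countType) (le : T -> T -> Prop) d1 d2
    (M1 : orderType d1) (M2 : orderType d2) (F : T -> M1 -> M2 -> Prop) (s0 : T) :
    approximation le F -> homogeneous_order M1 -> homogeneous_order M2 ->
  order_iso M1 M2.
Proof.
move=> apF hM1 hM2.
pose rels := {E : M1 -> M2 -> Prop | coarse_iso (fun=> True) (fun=> True) E}.
have /choice[next nextP] : forall p : rels * T, exists E' : rels,
    [/\ forall x y, sval E' x y -> sval p.1 x y, sharpens F p.2 (sval E') &
        sharpens (fun s => flip (F s)) p.2 (flip (sval E'))].
  move=> [[E ciE] t]; have [E' [ciE' sub shl shr]] := coarse_iso_sharpen_both t apF hM1 hM2 ciE.
  by exists (exist _ E' ciE').
pose E0 : rels := exist _ _ (coarse_iso_unseparated apF s0).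
pose E := fix E n := if n is n'.+1
  then if unpickle n' is Some t then next (E n', t) else E n' else E0.
have ES t : exists n, E n.+1 = next (E n, t) by exists (pickle t); rewrite /= pickleK.
apply: (@coarse_iso_limit _ _ _ _ (fun n => sval (E n))) => [n|n x y|x|y].
- exact: svalP.
- by rewrite /=; case: (unpickle n) => // t; have [+ _ _] := nextP (E n, t); apply.
- have [t [y [_ Ft]]] := ap_left apF s0 x; have [n En] := ES t.
  exists n.+1 => y'; rewrite En => Exy; have [_ sh _] := nextP (E n, t).
  exact: sh _ _ _ Ft Exy.
- have [t [x [_ Ft]]] := ap_right apF s0 y; have [n En] := ES t.
  exists n.+1 => x'; rewrite En => Exy; have [_ _ sh] := nextP (E n, t).
  by apply: sharp_flip; apply: sh Ft Exy.
Qed.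

(** * The forcing relation *)

Lemma stronger_refl p : stronger p p.
Proof. exact: prefix_refl. Qed.

Lemma stronger_trans q p r : stronger r q -> stronger q p -> stronger r p.
Proof. by move=> rq qp; apply: prefix_trans qp rq. Qed.

Hint Resolve stronger_refl : core.

Lemma dense_mono p q D : stronger q p -> dense_below p D -> dense_below q D.
Proof. by move=> qp dD r rq; apply: dD; apply: stronger_trans rq qp. Qed.

Lemma dense_sub p (D D' : cohen -> Prop) :
    (forall r, stronger r p -> D r -> D' r) ->
  dense_below p D -> dense_below p D'.
Proof.
move=> DD' dD q qp; have [r rq Dr] := dD q qp.
by exists r => //; apply: DD' => //; apply: stronger_trans rq qp.
Qed.

Lemma dense_here p (D : cohen -> Prop) :
  (forall q, stronger q p -> D q) -> dense_below p D.
Proof. by move=> Dp q qp; exists q => //; apply: Dp. Qed.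

Lemma dense_dense p D :
  dense_below p (fun r => dense_below r D) -> dense_below p D.
Proof.
move=> ddD q qp; have [r rq /(_ r (stronger_refl r))[r' r'r Dr']] := ddD q qp.
by exists r' => //; apply: stronger_trans r'r rq.
Qed.

Lemma force_eq_mono s t p q : stronger q p -> force_eq s t p -> force_eq s t q.
Proof.
case: s t => [X f c] [Y g d] qp /= [st ts].
by split=> [i r rq|j r rq]; [apply: st | apply: ts]; apply: stronger_trans rq qp.
Qed.

Lemma force_mem_mono s t p q : stronger q p -> force_mem s t p -> force_mem s t q.
Proof. by case: t => [Y g d] qp /=; apply: dense_mono. Qed.

Lemma forces_mono phi p q : stronger q p -> forces p phi -> forces q phi.
Proof.
elim: phi p q => [s t|s t|phi IH|phi IHphi psi IHpsi|F IH] p q qp /=.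
- exact: force_mem_mono.
- exact: force_eq_mono.
- by move=> np r rq; apply: np; apply: stronger_trans rq qp.
- by case=> ? ?; split; [apply: IHphi qp _ | apply: IHpsi qp _].
- by move=> pF t; apply: IH qp _.
Qed.

Lemma force_eq_dense s t p : dense_below p (force_eq s t) -> force_eq s t p.
Proof.
case: s t => [X f c] [Y g d] dst; split=> [i q qp qc|j q qp qd];
  apply: dense_dense => r rq; have [r' r'r [st ts]] := dst r (stronger_trans rq qp);
  exists r' => //; [apply: st | apply: ts] => //;
  apply: stronger_trans (stronger_trans r'r rq) _ => //.
Qed.

Lemma forces_dense phi p : dense_below p (forces^~ phi) -> forces p phi.
Proof.
elim: phi p => [s [Y g d]|s t|phi IH|phi IHphi psi IHpsi|F IH] p /=.
- exact: dense_dense.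
- exact: force_eq_dense.
- move=> dn q qp qphi; have [r rq nr] := dn q qp.
  by apply: (nr r) => //; apply: forces_mono qphi.
- by move=> dp; split; [apply: IHphi | apply: IHpsi]; apply: dense_sub dp => r _ [].
- by move=> dF t; apply: IH; apply: dense_sub dF => r _.
Qed.

Lemma force_eq_refl s p : force_eq s s p.
Proof.
elim: s p => [X f IH c] p; split=> i q qp qc; apply: dense_here => r rq;
  by exists i => //; apply: stronger_trans rq qc.
Qed.

Lemma force_eq_sym s t p : force_eq s t p -> force_eq t s p.
Proof.
elim: s t p => [X f IH c] [Y g d] p [st ts].
split=> [j q qp qd|i q qp qc]; [move: (ts j q qp qd) | move: (st i q qp qc)];
  by apply: dense_sub => r _ [k rk /IH]; exists k.
Qed.

Lemma force_eq_trans s t u p : force_eq s t p -> force_eq t u p -> force_eq s u p.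
Proof.
elim: s t u p => [X f IH c] [Y g d] [Z h e] p [st ts] [tu ut].
split=> [i q qp qc|k q qp qe].
  apply: dense_dense; apply: dense_sub (st i q qp qc) => r rq [j rj ij].
  apply: dense_sub (tu j r (stronger_trans rq qp) rj) => r' r'r [k r'k jk].
  by exists k => //; apply: IH jk; apply: force_eq_mono ij.
apply: dense_dense; apply: dense_sub (ut k q qp qe) => r rq [j rj jk].
apply: dense_sub (ts j r (stronger_trans rq qp) rj) => r' r'r [i r'i ij].
by exists i => //; apply: IH ij _; apply: force_eq_mono jk.
Qed.

Lemma force_mem_eql s s' t p : force_eq s s' p -> force_mem s t p -> force_mem s' t p.
Proof.
case: t => [Y g d] ss'; apply: dense_sub => r rp [j rj sj]; exists j => //.
by apply: force_eq_trans sj; apply: force_eq_sym; apply: force_eq_mono ss'.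
Qed.

Lemma force_mem_eqr s t t' p : force_eq t t' p -> force_mem s t p -> force_mem s t' p.
Proof.
case: t t' => [Y g d] [Z h e] [tt' _] st.
apply: dense_dense; apply: dense_sub st => r rp [j rj sj].
apply: dense_sub (tt' j r rp rj) => r' r'r [k r'k jk].
by exists k => //; apply: force_eq_trans jk; apply: force_eq_mono sj.
Qed.

Lemma force_mem_elt X (f : X -> name) c i p : stronger p (c i) -> force_mem (f i) (Name f c) p.
Proof.
move=> pc; apply: dense_here => q qp; exists i; first exact: stronger_trans pc.
exact: force_eq_refl.
Qed.

(** Extensionality: only the elements of the two names have to be
tested, as each is forced into its name by its own condition. *)
Lemma force_ext s t p :
    (forall v q, stronger q p -> (force_mem v s q <-> force_mem v t q)) ->
  force_eq s t p.
Proof.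
case: s t => [X f c] [Y g d] st; split=> [i q qp qc|j q qp qd].
  exact/(st (f i) q qp)/force_mem_elt.
have : force_mem (g j) (Name f c) q by apply/(st (g j) q qp)/force_mem_elt.
by apply: dense_sub => r _ [i ri /force_eq_sym]; exists i.
Qed.

Lemma forces_imp p phi psi :
  forces p (Imp phi psi) <->
  forall q, stronger q p -> forces q phi -> forces q psi.
Proof.
split=> [pi q qp qphi|pi q qp [qphi nq]]; last exact: nq (stronger_refl q) (pi q qp qphi).
apply: forces_dense => r rq; apply: contrapT => nr.
apply: (pi r (stronger_trans rq qp)); split; first exact: forces_mono qphi.
by move=> r' r'r r'psi; apply: nr; exists r'.
Qed.

Lemma forces_iff p phi psi :
  forces p (Iff phi psi) <->
  forall q, stronger q p -> (forces q phi <-> forces q psi).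
Proof.
split=> [[/forces_imp pq /forces_imp qp] q sq|pq]; first by split; [apply: pq | apply: qp].
by split; apply/forces_imp => q /pq[].
Qed.

Lemma forces_or p phi psi :
  forces p (Or phi psi) <->
  dense_below p (fun r => forces r phi \/ forces r psi).
Proof.
split=> [po q qp|po q qp [nphi npsi]]; last first.
  by have [r rq [/nphi|/npsi]] := po q qp; apply.
apply: contrapT => nq; apply: (po q qp).
by split=> r rq rf; apply: nq; exists r => //; [left | right].
Qed.

Lemma forces_ex p F :
  forces p (Ex F) <-> dense_below p (fun r => exists t, forces r (F t)).
Proof.
split=> [pe q qp|pe q qp nq]; last by have [r rq [t]] := pe q qp; apply: nq.
by apply: contrapT => nq; apply: (pe q qp) => t r rq rF; apply: nq; exists r => //; exists t.
Qed.

(** * Absoluteness of equality, membership and ordered pairs *)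

Lemma geq_refl a : geq a a.
Proof. by elim: a => X f IH; split=> i; exists i. Qed.

Lemma geq_sym a b : geq a b -> geq b a.
Proof.
elim: a b => X f IH [Y g] [ab ba].
by split=> [j|i]; [have [i /IH] := ba j; exists i | have [j /IH] := ab i; exists j].
Qed.

Lemma geq_trans a b c : geq a b -> geq b c -> geq a c.
Proof.
elim: a b c => X f IH [Y g] [Z h] [ab ba] [bc cb]; split=> [i|k].
  by have [j ij] := ab i; have [k jk] := bc j; exists k; apply: IH ij jk.
by have [j jk] := cb k; have [i ij] := ba j; exists i; apply: IH ij jk.
Qed.

Lemma geq_upair a b c d : geq (gupair a b) (gupair c d) ->
  [/\ geq a c \/ geq a d, geq b c \/ geq b d, geq a c \/ geq b c & geq a d \/ geq b d].
Proof.
move=> [ab cd]; split.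
- by have [[]] := ab true; [left | right].
- by have [[]] := ab false; [left | right].
- by have [[]] := cd true; [left | right].
- by have [[]] := cd false; [left | right].
Qed.

Lemma geq_opair a b c d : geq (gopair a b) (gopair c d) -> geq a c /\ geq b d.
Proof.
move=> /geq_upair[aa ab cc cd].
have ac : geq a c by case: aa => /geq_upair[_ _ []].
split=> //.
have bb : geq b c \/ geq b d.
  by case: ab => /geq_upair[_ [] ? _ _]; [left | left | left | right].
have dd : geq a d \/ geq b d by case: cd => /geq_upair[_ _ _ []]; [left | left | left | right].
case: bb => // bc; case: dd => // ad.
exact: geq_trans bc (geq_trans (geq_sym ac) ad).
Qed.

Lemma force_eq_check a b p : force_eq (check a) (check b) p <-> geq a b.
Proof.
elim: a b p => X f IH [Y g] p; split=> [[ab ba]|[ab ba]]; split.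
- move=> i; have [r _ [j _ /IH]] := ab i p (stronger_refl p) (prefix0s p) p (stronger_refl p).
  by exists j.
- move=> j; have [r _ [i _ /IH]] := ba j p (stronger_refl p) (prefix0s p) p (stronger_refl p).
  by exists i.
- move=> i q _ _; have [j ij] := ab i; apply: dense_here => r _.
  by exists j; [exact: prefix0s | apply/IH].
- move=> j q _ _; have [i ij] := ba j; apply: dense_here => r _.
  by exists i; [exact: prefix0s | apply/IH].
Qed.

Lemma force_mem_check v X (f : X -> gset) p :
  force_mem v (check (GSet f)) p <->
  dense_below p (fun r => exists i, force_eq v (check (f i)) r).
Proof.
by split; apply: dense_sub => r _ [i]; exists i => //; apply: prefix0s.
Qed.

Lemma check_mem_check a X (f : X -> gset) p :
  force_mem (check a) (check (GSet f)) p <-> exists i, geq a (f i).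
Proof.
split=> [/force_mem_check/(_ p (stronger_refl p))[r _ [i /force_eq_check]]|[i ai]].
  by exists i.
by apply/force_mem_check; apply: dense_here => r _; exists i; apply/force_eq_check.
Qed.

(** A set defined by its elements, as pairs are, is forced equal to any name with
the same elements.  This replaces the defining formulas of pairs by equations with
check names. *)
Lemma forces_collection G u z p :
    (forall w q, forces q (G w) <-> force_mem w u q) ->
  forces p (All (fun w => Iff (Mem w z) (G w))) <-> force_eq z u p.
Proof.
move=> Gu; split=> [pz|pz w].
  apply: force_ext => v q qp; have [zG Gz] := proj1 (forces_iff p (Mem v z) (G v)) (pz v) q qp.
  by split=> [/zG/Gu|/Gu/Gz].
apply: (proj2 (forces_iff p (Mem w z) (G w))) => q qp; have {}pz := force_eq_mono qp pz.
split=> [wz|/Gu wu]; first by apply/Gu; apply: force_mem_eqr pz wz.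
by apply: force_mem_eqr wu; apply: force_eq_sym.
Qed.

Lemma forces_upair z a b p :
  forces p (IsUpair z (check a) (check b)) <-> force_eq z (check (gupair a b)) p.
Proof.
apply: forces_collection => w q; split=> [/forces_or|/force_mem_check] dw;
  [apply/force_mem_check | apply/forces_or]; apply: dense_sub dw => r _.
  by case=> /= e; [exists true | exists false].
by case=> -[] e; [left | right].
Qed.

Lemma forces_opair z a b p :
  forces p (IsOpair z (check a) (check b)) <-> force_eq z (check (gopair a b)) p.
Proof.
apply: forces_collection => w q; split=> [/forces_or|/force_mem_check] dw;
  [apply/force_mem_check | apply/forces_or]; apply: dense_sub dw => r _.
  by case=> /forces_upair e; [exists true | exists false].
by case=> -[] /forces_upair e; [left | right].
Qed.

Lemma forces_mempair a b R p :
  forces p (MemPair (check a) (check b) R) <-> force_mem (check (gopair a b)) R p.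
Proof.
split=> [/forces_ex pz|pR].
  apply: (forces_dense (phi := Mem _ _)); apply: dense_sub pz => r _ [z [/= zR /forces_opair ez]].
  exact: force_mem_eql ez zR.
apply/forces_ex; apply: dense_here => q qp; exists (check (gopair a b)); split.
  exact: force_mem_mono pR.
by apply/forces_opair; apply: force_eq_refl.
Qed.

(** Substitution of equals in the instances of a quantifier is not automatic: [All]
takes arbitrary functions on names. *)
Definition respects (F : name -> formula) : Prop :=
  forall p t u, force_eq t u p -> forces p (F t) -> forces p (F u).

Lemma respects_const phi : respects (fun=> phi).
Proof. by []. Qed.

Lemma respects_meml A : respects (fun t => Mem t A).
Proof. by move=> p t u; apply: force_mem_eql. Qed.

Lemma respects_memr A : respects (fun t => Mem A t).
Proof. by move=> p t u; apply: force_mem_eqr. Qed.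

Lemma respects_eql A : respects (fun t => Eq t A).
Proof. by move=> p t u /force_eq_sym; apply: force_eq_trans. Qed.

Lemma respects_eqr A : respects (fun t => Eq A t).
Proof. by move=> p t u tu At; apply: force_eq_trans At tu. Qed.

Lemma respects_not F : respects F -> respects (fun t => Not (F t)).
Proof.
move=> rF p t u tu nt q qp qu; apply: (nt q qp).
by apply: rF qu; apply: force_eq_sym; apply: force_eq_mono tu.
Qed.

Lemma respects_and F G : respects F -> respects G -> respects (fun t => And (F t) (G t)).
Proof. by move=> rF rG p t u tu [Ft Gt]; split; [apply: rF Ft | apply: rG Gt]. Qed.

Lemma respects_all G : (forall w, respects (fun t => G t w)) -> respects (fun t => All (G t)).
Proof. by move=> rG p t u tu Gt w; apply: rG (Gt w). Qed.

Ltac solve_respects := repeat first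
  [ exact: respects_const | exact: respects_meml | exact: respects_memr
  | exact: respects_eql | exact: respects_eqr | apply: respects_and
  | apply: respects_not | (apply: respects_all; intro) ].

Lemma forces_allin_elim X (f : X -> gset) F p :
  forces p (AllIn (check (GSet f)) F) -> forall i, forces p (F (check (f i))).
Proof.
move=> pF i; apply: (proj1 (forces_imp p (Mem _ (check (GSet f))) _) (pF (check (f i)))) => //.
by apply/check_mem_check; exists i; apply: geq_refl.
Qed.

Lemma forces_allin_intro X (f : X -> gset) F p : respects F ->
  (forall i, forces p (F (check (f i)))) -> forces p (AllIn (check (GSet f)) F).
Proof.
move=> rF pF t; apply: (proj2 (forces_imp p (Mem t (check (GSet f))) (F t))).
move=> q qp /force_mem_check tf; apply: forces_dense.
apply: dense_sub tf => r rq [i /force_eq_sym ti]; apply: rF ti _.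
by apply: forces_mono (pF i); apply: stronger_trans qp.
Qed.

Lemma forces_exin_elim X (f : X -> gset) F p : respects F ->
    forces p (ExIn (check (GSet f)) F) ->
  dense_below p (fun r => exists i, forces r (F (check (f i)))).
Proof.
move=> rF /forces_ex pF; apply: dense_dense.
apply: dense_sub pF => r rp [t [/force_mem_check tf Ft]].
apply: dense_sub tf => r' r'r [i ti]; exists i.
by apply: rF ti _; apply: forces_mono Ft.
Qed.

Lemma forces_exin_intro X (f : X -> gset) F p i :
  forces p (F (check (f i))) -> forces p (ExIn (check (GSet f)) F).
Proof.
move=> Fi; apply/forces_ex; apply: dense_here => q qp; exists (check (f i)).
split; last exact: forces_mono Fi.
by apply/check_mem_check; exists i; apply: geq_refl.
Qed.

(** * Forced isomorphisms between linear orders *)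

Section Isomorphism.
Variables (d1 d2 : Order.disp_t) (M1 : orderType d1) (M2 : orderType d2).
Variables (c1 : M1 -> gset) (c2 : M2 -> gset).
Hypotheses (hc1 : coding c1) (hc2 : coding c2).

Lemma forces_glt d (M : orderType d) (c : M -> gset) x y p : coding c ->
  forces p (MemPair (check (c x)) (check (c y)) (check (glt c))) <-> x < y.
Proof.
move=> hc; split=> [/forces_mempair/check_mem_check[[[a b] ab] /=]|xy].
  by move=> /geq_opair[/hc-> /hc->].
apply/forces_mempair/check_mem_check.
by exists (exist (fun xy : M * M => xy.1 < xy.2) (x, y) xy); apply: geq_refl.
Qed.

Definition name_value phi p x y : Prop :=
  force_mem (check (gopair (c1 x) (c2 y))) phi p.

(** Conditions below [p] are written [p ++ s], so that all of [cohen] serves as the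
index type.  The order is linear, so preserving it makes the decided values single
and the partial maps injective. *)
Lemma isomorphism_approximation p phi :
    forces p (IsFunction phi (check (gcarrier c1)) (check (gcarrier c2))) ->
    forces p (IsSurjective phi (check (gcarrier c1)) (check (gcarrier c2))) ->
    forces p (PreservesRel phi (check (gcarrier c1)) (check (glt c1))
                               (check (gcarrier c2)) (check (glt c2))) ->
  approximation stronger (fun s => name_value phi (p ++ s)).
Proof.
move=> func surj pres.
have total : forces p (AllIn (check (gcarrier c1))
    (fun x => ExIn (check (gcarrier c2)) (fun y => MemPair x y phi))).
  by have [_ []] := func.
have cat_stronger s t : stronger t s -> stronger (p ++ t) (p ++ s).
  by move=> /prefixP[w ->]; apply/prefixP; exists w; rewrite catA.
have cat_below s r : stronger r (p ++ s) -> exists2 t, stronger t s & r = p ++ t.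
  by move=> /prefixP[w ->]; exists (s ++ w); [apply: prefix_prefix | rewrite catA].
have below s : stronger (p ++ s) p by exact: prefix_prefix.
split.
- exact: stronger_refl.
- by move=> t s r; apply: stronger_trans.
- by move=> s t x y /cat_stronger st; apply: force_mem_mono.
- move=> s x; have := forces_exin_elim _ (forces_allin_elim total x).
  case/(_ ltac:(solve_respects) (p ++ s) (below s)) => r /cat_below[t ts ->] [y].
  by move=> /forces_mempair xy; exists t, y.
- move=> s y; have := forces_exin_elim _ (forces_allin_elim surj y).
  case/(_ ltac:(solve_respects) (p ++ s) (below s)) => r /cat_below[t ts ->] [x].
  by move=> /forces_mempair xy; exists t, x.
move=> s x y x' y' xy x'y'.
have H := forces_allin_elim (forces_allin_elim
  (forces_allin_elim (forces_allin_elim pres x) x') y) y'.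
have both : forces (p ++ s) (And (MemPair (check (c1 x)) (check (c2 y)) phi)
                                 (MemPair (check (c1 x')) (check (c2 y')) phi)).
  by split; apply/forces_mempair.
have [lt gt] := proj1 (forces_iff _ _ _) (proj1 (forces_imp _ _ _) H _ (below s) both)
                      _ (stronger_refl _).
apply/idP/idP.
  by move=> /(forces_glt _ _ (p ++ s) hc1)/lt/(forces_glt _ _ _ hc2).
by move=> /(forces_glt _ _ (p ++ s) hc2)/gt/(forces_glt _ _ _ hc1).
Qed.

Definition graph_name (f : M1 -> M2) : name :=
  check (GSet (fun x => gopair (c1 x) (c2 (f x)))).

Lemma forces_graph f x y p :
  forces p (MemPair (check (c1 x)) (check (c2 y)) (graph_name f)) <-> y = f x.
Proof.
rewrite /graph_name; split=> [/forces_mempair/check_mem_check[x' /geq_opair[/hc1-> /hc2->]]//|->].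
by apply/forces_mempair/check_mem_check; exists x; apply: geq_refl.
Qed.

Lemma order_iso_forced : order_iso M1 M2 ->
  forced (Isomorphic (check (gcarrier c1)) (check (glt c1))
                     (check (gcarrier c2)) (check (glt c2))).
Proof.
move=> [f [g fK gK] f_lt] p; apply/forces_ex; apply: dense_here => {p}p _.
exists (graph_name f); split; [split; [|split] | split; [|split]].
- apply: forces_allin_intro => [|x]; first by solve_respects.
  apply: (forces_exin_intro (i := x)); apply: (forces_exin_intro (i := f x)).
  by apply/forces_opair; apply: force_eq_refl.
- apply: forces_allin_intro => [|x]; first by solve_respects.
  by apply: (forces_exin_intro (i := f x)); apply/forces_graph.
- do 3![apply: forces_allin_intro => [|?]; first by solve_respects].
  apply/forces_imp => q _ [/forces_graph-> /forces_graph->].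
  exact: force_eq_refl.
- do 3![apply: forces_allin_intro => [|?]; first by solve_respects].
  apply/forces_imp => q _ [/forces_graph-> /forces_graph/(can_inj fK)->].
  exact: force_eq_refl.
- apply: forces_allin_intro => [|y]; first by solve_respects.
  by apply: (forces_exin_intro (i := g y)); apply/forces_graph.
do 4![apply: forces_allin_intro => [|?]; first by solve_respects].
apply/forces_imp => q _ [/forces_graph-> /forces_graph->].
apply/forces_iff => r _; split=> /forces_glt xy; apply/forces_glt => //.
  by rewrite f_lt xy.
by rewrite -f_lt xy.
Qed.

Lemma forced_order_iso : homogeneous_order M1 -> homogeneous_order M2 ->
  forced (Isomorphic (check (gcarrier c1)) (check (glt c1))
                     (check (gcarrier c2)) (check (glt c2))) ->
  order_iso M1 M2.
Proof.
move=> hM1 hM2 iso.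
have [p _ [phi [func [_ [surj pres]]]]] :=
  proj1 (forces_ex [::] _) (iso [::]) [::] (stronger_refl _).
exact: (approximation_iso [::] (isomorphism_approximation func surj pres)).
Qed.

End Isomorphism.

Theorem theorem5p2 (d1 d2 : Order.disp_t)
    (M1 : orderType d1) (M2 : orderType d2)
    (hM1 : homogeneous_order M1) (hM2 : homogeneous_order M2)
    (c1 : M1 -> gset) (c2 : M2 -> gset)
    (hc1 : coding c1) (hc2 : coding c2) :
  order_iso M1 M2 <->
  forced (Isomorphic (check (gcarrier c1)) (check (glt c1))
                     (check (gcarrier c2)) (check (glt c2))).
Proof.
by split; [apply: order_iso_forced | apply: forced_order_iso].
Qed.
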